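(* Let $k=\mathbb{F}_q$ be a finite field with $q$ elements, let $Q=(1\to 2)$ be the quiver of type $A_2$, let $a$ be a natural number, and let $V=P_1^a$ be the direct sum of $a$ copies of the indecomposable projective representation $P_1=(k\xrightarrow{\ \mathrm{id}\ }k)$. Then the subrepresentation poset $(\mathcal{P}_V,\leq)$ is Sperner.
   Context: A representation $V$ of the quiver $1\xrightarrow{\alpha}2$ over $k$ consists of finite-dimensional $k$-vector spaces $V_1,V_2$ and a $k$-linear map $V_\alpha\colon V_1\to V_2$; direct sums are formed componentwise. A subrepresentation $U\subseteq V$ consists of subspaces $U_1\subseteq V_1$, $U_2\subseteq V_2$ with $V_\alpha(U_1)\subseteq U_2$, with the restricted map. $\mathcal{P}_V$ is the set of all subrepresentations of $V$, ordered by $U\leq U'$ if and only if $U$ is a subrepresentation of $U'$. This finite, bounded poset is graded by the degree map $U\mapsto\dim_k(U)=\dim_k U_1+\dim_k U_2$. A poset $P$ is graded by $\deg\colon P\to\mathbb{N}$ if $\deg(x)=0$ for all minimal elements $x$ and $\deg(x)=\deg(y)+1$ whenever $x$ covers $y$. For a finite, bounded, graded poset $P$, let $P_i$ denote the set of elements of degree $i$; $P$ is called Sperner if there exists a natural number $i$ such that $|\mathcal{F}|\leq|P_i|$ for every antichain $\mathcal{F}\subseteq P$ (an antichain being a subset of pairwise incomparable elements). *)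

(* Defs.v *)
From HB Require Import structures.
From mathcomp Require Import all_boot all_order all_algebra.

Set Implicit Arguments.
Unset Strict Implicit.
Unset Printing Implicit Defensive.

Import Order.TTheory GRing.Theory.
Local Open Scope ring_scope.

Section Graded.
Variables (d : Order.disp_t) (P : porderType d).
Implicit Types x y z : P.
Local Open Scope order_scope.

Definition minimal x := forall y, ~ (y < x).

Definition covers x y := y < x /\ forall z, ~ (y < z /\ z < x).

Definition graded_by (deg : P -> nat) :=
  (forall x, minimal x -> deg x = 0%N) /\
  (forall x y, covers x y -> deg x = (deg y).+1).

End Graded.

Structure gradedPoset (d : Order.disp_t) := GradedPoset {
  graded_sort :> finTBPOrderType d;
  degree : graded_sort -> nat;
  _ : graded_by degree
}.

Section Sperner.
Variables (d : Order.disp_t) (P : gradedPoset d).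

Definition antichain (F : {set P}) :=
  forall x y, x \in F -> y \in F -> x != y -> (x >< y)%O.

Definition rank_level (i : nat) : {set P} := [set x | degree x == i].

Definition Sperner :=
  exists i : nat, forall F : {set P}, antichain F -> (#|F| <= #|rank_level i|)%N.

End Sperner.

(* A representation of the quiver 1 -> 2 over k; a vectType is finite-dimensional. *)
Record rep (k : fieldType) := Rep {
  rep1 : vectType k;
  rep2 : vectType k;
  rep_map : 'Hom(rep1, rep2)
}.

(* The indecomposable projective at the vertex 1. *)
Definition P1 (k : fieldType) : rep k := @Rep k k^o k^o \1%VF.

Section Power.
Variables (k : fieldType) (a : nat) (V : rep k).

Definition pow_map (v : {ffun 'I_a -> rep1 V}) : {ffun 'I_a -> rep2 V} :=
  [ffun i => rep_map V (v i)].

Fact pow_map_linear : linear pow_map.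
Proof. by move=> c u v; apply/ffunP=> i; rewrite !ffunE linearP. Qed.

HB.instance Definition _ :=
  GRing.isLinear.Build k {ffun 'I_a -> rep1 V} {ffun 'I_a -> rep2 V} _ pow_map
    pow_map_linear.

(* The direct sum of a copies of V, formed componentwise. *)
Definition rep_pow : rep k := Rep (linfun pow_map).

Lemma rep_powE (v : rep1 rep_pow) : rep_map rep_pow v = pow_map v.
Proof. exact: lfunE. Qed.

End Power.

Record subrep (k : fieldType) (V : rep k) := Subrep {
  subrep_pair : {vspace rep1 V} * {vspace rep2 V};
  _ : (rep_map V @: subrep_pair.1 <= subrep_pair.2)%VS
}.

Section SubrepOrder.
Variables (k : fieldType) (V : rep k).
Implicit Types U W : subrep V.

HB.instance Definition _ := [isSub for @subrep_pair k V].
HB.instance Definition _ := [Choice of subrep V by <:].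

Definition sub1 U : {vspace rep1 V} := (subrep_pair U).1.
Definition sub2 U : {vspace rep2 V} := (subrep_pair U).2.

Lemma subrepP U : (rep_map V @: sub1 U <= sub2 U)%VS.
Proof. by case: U. Qed.

Lemma subrep_eq U W : sub1 U = sub1 W -> sub2 U = sub2 W -> U = W.
Proof.
by move=> e1 e2; apply: val_inj; rewrite /= [LHS]surjective_pairing
  [RHS]surjective_pairing; congr (_, _).
Qed.

(* The structure map of a subrepresentation is a restriction of that of V, so
   containment of subrepresentations is componentwise containment. *)
Definition subrep_le U W := (sub1 U <= sub1 W)%VS && (sub2 U <= sub2 W)%VS.

Fact subrep_le_refl : reflexive subrep_le.
Proof. by move=> U; rewrite /subrep_le !subvv. Qed.

Fact subrep_le_anti : antisymmetric subrep_le.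
Proof.
move=> U W /andP[/andP[h1 h2] /andP[h3 h4]].
by apply: subrep_eq; apply/eqP; rewrite eqEsubv ?h1 ?h2 ?h3 ?h4.
Qed.

Fact subrep_le_trans : transitive subrep_le.
Proof.
move=> U W X /andP[h1 h2] /andP[h3 h4].
by rewrite /subrep_le (subv_trans h1 h3) (subv_trans h2 h4).
Qed.

Fact subrep_display : Order.disp_t. Proof. exact: (Order.Disp tt tt). Qed.

HB.instance Definition _ := Order.Le_isPOrder.Build subrep_display (subrep V)
  subrep_le_refl subrep_le_anti subrep_le_trans.

Fact subrep0_subproof :
  (rep_map V @: (0%VS : {vspace rep1 V}, 0%VS : {vspace rep2 V}).1
     <= (0%VS : {vspace rep1 V}, 0%VS : {vspace rep2 V}).2)%VS.
Proof. by rewrite /= limg0 subvv. Qed.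

Definition subrep0 : subrep V := Subrep subrep0_subproof.

Fact subrep1_subproof :
  (rep_map V @: ({:rep1 V}%VS, {:rep2 V}%VS).1
     <= ({:rep1 V}%VS, {:rep2 V}%VS).2)%VS.
Proof. exact: subvf. Qed.

Definition subrep1 : subrep V := Subrep subrep1_subproof.

Fact subrep_le0x U : (subrep0 <= U)%O.
Proof. by apply/andP; split; apply: sub0v. Qed.

Fact subrep_lex1 U : (U <= subrep1)%O.
Proof. by apply/andP; split; apply: subvf. Qed.

HB.instance Definition _ :=
  Order.hasBottom.Build subrep_display (subrep V) subrep_le0x.
HB.instance Definition _ :=
  Order.hasTop.Build subrep_display (subrep V) subrep_lex1.

Definition subrep_dim U : nat := (\dim (sub1 U) + \dim (sub2 U))%N.

Lemma dim_add_line (vT : vectType k) (A : {vspace vT}) (v : vT) :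
  v \notin A -> \dim (A + <[v]>) = (\dim A).+1.
Proof.
move=> vA; have v0 : v != 0 by apply: contraNneq vA => ->; rewrite mem0v.
rewrite dimv_disjoint_sum ?dim_vline ?v0 ?addn1 //.
apply/eqP; rewrite -subv0; apply/subvP=> w /memv_capP[wA /vlineP[c cw]].
rewrite memv0 cw; have [->|c0] := eqVneq c 0; first by rewrite scale0r.
by move: wA; rewrite cw rpredZeq (negPf c0) (negPf vA).
Qed.

Lemma subrep_lt_step U W : (U < W)%O ->
  exists X : subrep V,
    [/\ (U < X)%O, (X <= W)%O & subrep_dim X = (subrep_dim U).+1].
Proof.
move=> ltUW; have /andP[le1 le2] := ltW ltUW.
have lt_dim X : (U <= X)%O -> subrep_dim X = (subrep_dim U).+1 -> (U < X)%O.
  move=> leUX dX; rewrite lt_neqAle leUX andbT.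
  by apply/eqP=> eUX; move: dX; rewrite -eUX => /esym/eqP; rewrite eqn_leq ltnn.
have [s2|/subvPn[v vW vU]] := boolP (sub2 W <= sub2 U)%VS.
  have [s1|/subvPn[v vW vU]] := boolP (sub1 W <= sub1 U)%VS.
    by move: ltUW; rewrite lt_leAnge => /andP[_ /negP[]]; apply/andP.
  have XP : (rep_map V @: (sub1 U + <[v]>, sub2 U)%VS.1
               <= (sub1 U + <[v]>, sub2 U)%VS.2)%VS.
    rewrite /= limgD subv_add subrepP limg_line -memvE.
    apply: (subvP s2); apply: (subvP (subrepP W)); exact: memv_img.
  have dX : subrep_dim (Subrep XP) = (subrep_dim U).+1.
    by rewrite /subrep_dim /= /sub1 /sub2 /= dim_add_line ?addSn.
  exists (Subrep XP); split=> //.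
  - by apply: lt_dim => //; apply/andP; rewrite /sub1 /sub2 /= addvSl subvv.
  - by apply/andP; rewrite /sub1 /sub2 /= subv_add le1 le2 -memvE vW.
have XP : (rep_map V @: (sub1 U, sub2 U + <[v]>)%VS.1
             <= (sub1 U, sub2 U + <[v]>)%VS.2)%VS.
  exact: subv_trans (subrepP U) (addvSl _ _).
have dX : subrep_dim (Subrep XP) = (subrep_dim U).+1.
  by rewrite /subrep_dim /= /sub1 /sub2 /= dim_add_line ?addnS.
exists (Subrep XP); split=> //.
- by apply: lt_dim => //; apply/andP; rewrite /sub1 /sub2 /= addvSl subvv.
- by apply/andP; rewrite /sub1 /sub2 /= subv_add le1 le2 -memvE vW.
Qed.

Lemma subrep_dim_graded : graded_by subrep_dim.
Proof.
split=> [U minU | W U [ltUW noX]].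
  have -> : U = subrep0.
    apply/eqP; apply/negPn/negP=> U0; apply: (minU subrep0).
    by rewrite lt_neqAle subrep_le0x andbT eq_sym.
  by rewrite /subrep_dim /sub1 /sub2 /= !dimv0.
have [X [ltUX leXW dX]] := subrep_lt_step ltUW.
move: leXW; rewrite le_eqVlt => /orP[/eqP<- // | ltXW].
by case: (noX X).
Qed.

End SubrepOrder.

Section SubrepFinite.
Variable k : finFieldType.

HB.instance Definition _ (vT : vectType k) :=
  CanIsCountable (@VectorInternalTheory.vs2mxK k vT).
HB.instance Definition _ (vT : vectType k) :=
  isFinite.Build {vspace vT}
    (pcan_enumP (can_pcan (@VectorInternalTheory.vs2mxK k vT))).

HB.instance Definition _ (V : rep k) := [Countable of subrep V by <:].
HB.instance Definition _ (V : rep k) := [Finite of subrep V by <:].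

Definition subrep_poset (V : rep k) : gradedPoset subrep_display :=
  @GradedPoset subrep_display (subrep V) (@subrep_dim k V)
    (@subrep_dim_graded k V).

End SubrepFinite.

(* Main.v *)
Require Import Defs.
From mathcomp Require Import all_boot all_order all_algebra finfield.
From mathcomp Require Import lra zify.

Set Implicit Arguments.
Unset Strict Implicit.
Unset Printing Implicit Defensive.

Import Order.TTheory GRing.Theory Num.Theory.
Local Open Scope ring_scope.

(** Since the structure map of [P_1^a] is an identity, a subrepresentation is a
    flag [A <= B] in [E = k^a].  Give it the type
    [(x, y, z) = (dim A, dim B/A, dim E/B)]; with [N = dim E = x + y + z] its
    degree is [2x + y], so it lies below, on or above degree [N] according to
    whether [x < z], [x = z] or [z < x].  The level of degree [N] is a largest
    antichain.

    Any antichain can be pushed into that level without losing elements, one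
    level at a time: replace its elements of lowest degree by their upper
    shadow, the set of their covers, and dually from above ([lift_antichain]).
    What has to be shown is that a set [F] of flags with [x < z] has a shadow at
    least as large as [F] ([leq_card_shadow]).  It is enough to put nonnegative
    weights on the covers so that the weights leaving a flag with [x < z] sum to
    1 and the weights entering any flag from such flags sum to at most 1.

    Write [n] for [1 + q + ... + q^(n-1)], the number of lines, and also of
    hyperplanes, of an [n]-dimensional space.  A flag of type [(x, y, z)] has
    [y] covers that enlarge [A] and [z] covers that enlarge [B]; it covers [x]
    flags by shrinking [A] and [y] flags by shrinking [B], these numbers being
    read as Gaussian integers.  So weights depending on the type only are
    described by one number per type, the share of its mass that a flag spends
    on enlarging [A], and the two conditions become statements about quotients
    of Gaussian integers ([weight_out], [weight_in]).  The right shares are read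
    off from the slack: when [y] is much larger than [x], enlarging [A] leads to
    far more numerous flags, and when [y] is much smaller than [x < z],
    enlarging [B] does.  In the border cases [y = x] and [y = x + 1] the
    targets on the preferred side may be saturated by these flags alone, although
    they also receive a little from another type; a fraction [q^-2] diverted to
    the other side makes room for it.

    The upper half needs no further estimate: reversing the order exchanges [x]
    with [z] and the enlarging of [A] with the shrinking of [B], and every count
    above is preserved. *)

(** * Gaussian integers and the weights *)

Lemma powers_le_half (v : rat) : 0 <= v -> 2 * v <= 1 ->
  [/\ 0 <= v ^+ 2, 2 * v ^+ 2 <= v, 0 <= v ^+ 3 & 4 * v ^+ 3 <= v].
Proof. by move=> v0 v2; split; nra. Qed.

(** The Gaussian integer [1 + q + ... + q^(n-1)]. *)
Definition gint (q n : nat) : nat := (\sum_(i < n) q ^ i)%N.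

(* Translating rational hypotheses, useless for goals on [nat], dominates the
   running time of lia; they are dropped first. *)
Ltac nat_lia :=
  repeat match goal with
    | H : is_true (Order.le _ _) |- _ => clear H
    | H : is_true (Order.lt _ _) |- _ => clear H
    | H : forall _, _ |- _ => clear H
    | H : @eq (GRing.PzRing.sort _) _ _ |- _ => clear H
    | H : and4 _ _ _ _ |- _ => clear H
  end; lia.

Section GaussianIntegers.
Variable q : nat.
Hypothesis q_gt1 : (1 < q)%N.
Local Notation g := (gint q).

Lemma gint0 : g 0 = 0%N.
Proof. by rewrite /gint big_ord0. Qed.

Lemma gintS n : g n.+1 = (q * g n).+1.
Proof.
rewrite /gint big_ord_recl expn0 add1n big_distrr /=.
by congr _.+1; apply: eq_bigr => i _; rewrite -expnS.
Qed.

Lemma gint_gt0 n : (0 < g n)%N = (0 < n)%N.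
Proof. by case: n => [|n]; rewrite ?gint0 ?gintS. Qed.

Lemma gint_predn n : (g n * q.-1)%N = (q ^ n - 1)%N.
Proof.
elim: n => [|n IHn]; first by rewrite gint0.
have q_pos : (0 < q ^ n)%N by rewrite expn_gt0 (ltnW q_gt1).
have -> : (g n.+1 * q.-1 = q * (g n * q.-1) + q.-1)%N by rewrite gintS; nia.
by rewrite IHn expnS; nia.
Qed.

Lemma leq_gint_expn m e : (g m * q ^ e <= g (m + e))%N.
Proof.
elim: e => [|e IHe]; first by rewrite muln1 addn0.
by rewrite addnS gintS expnS; nia.
Qed.

Lemma leq_gint m n : (m <= n)%N -> (g m <= g n)%N.
Proof.
move=> /subnKC <-; apply: leq_trans (leq_gint_expn _ _).
by rewrite leq_pmulr // expn_gt0 (ltnW q_gt1).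
Qed.

Local Notation u := ((q%:R : rat)^-1).

Lemma gint_ratio_le m n e : (m + e <= n)%N ->
  ((g m)%:R / (g n)%:R <= u ^+ e :> rat).
Proof.
move=> len; have [n0|n_gt0] := posnP n.
  by rewrite n0 gint0 invr0 mulr0 exprn_ge0 ?invr_ge0 ?ler0n.
rewrite exprVn ler_pdivrMr ?ltr0n ?gint_gt0 // mulrC ler_pdivlMr; last first.
  by rewrite exprn_gt0 ?ltr0n ?(ltnW q_gt1).
by rewrite -natrX -natrM ler_nat (leq_trans (leq_gint_expn m e)) ?leq_gint.
Qed.

Lemma gintS_ratio_le m n : (0 < n)%N -> (m <= n)%N ->
  ((g m.+1)%:R / (g n)%:R <= q%:R + 1 :> rat).
Proof.
move=> n_gt0 lemn; rewrite ler_pdivrMr ?ltr0n ?gint_gt0 //.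
rewrite natr1 -natrM ler_nat gintS.
have := leq_gint lemn; have := gint_gt0 n; rewrite n_gt0; nia.
Qed.

(** The part of the mass of a flag of type [(x, y, z)] carried by its covers that
    enlarge [A].  Such covers do not exist for [y = 0], hence the proviso
    [0 < x] on the diagonal. *)
Definition share (x y : nat) : rat :=
  if (x.+1 < y)%N then 1
  else if y == x.+1 then 1 - u ^+ 2
  else if (y == x) && (0 < x)%N then u ^+ 2
  else 0.

(** The weight of a single cover of a flag of type [(x, y, z)], [A] being enlarged
    in [weight1] and [B] in [weight2]. *)
Definition weight1 (x y : nat) : rat := share x y / (g y)%:R.
Definition weight2 (x y z : nat) : rat := (1 - share x y) / (g z)%:R.

Lemma share_1 x y : (x.+1 < y)%N -> share x y = 1.
Proof. by rewrite /share => ->. Qed.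

Lemma share_succ x y : y = x.+1 -> share x y = 1 - u ^+ 2.
Proof. by move=> ->; rewrite /share ltnn eqxx. Qed.

Lemma share_diag x y : (0 < x)%N -> y = x -> share x y = u ^+ 2.
Proof.
by move=> x_gt0 ->; rewrite /share ltnNge leqnSn /= ltn_eqF // eqxx x_gt0.
Qed.

Lemma share_0 x y : (y < maxn x 1)%N -> share x y = 0.
Proof.
move=> ltyx; rewrite /share (_ : (x.+1 < y)%N = false); last by lia.
rewrite (_ : (y == x.+1) = false); last by lia.
by case: ifP => //; lia.
Qed.

Let u_gt0 : 0 < u. Proof. by rewrite invr_gt0 ltr0n ltnW. Qed.
Let u_le2 : 2 * u <= 1.
Proof. by rewrite ler_pdivrMr ?ltr0n ?(ltnW q_gt1) // mul1r ler_nat. Qed.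
Let qu : q%:R * u ^+ 2 = u.
Proof. by rewrite expr2 mulrA mulfV ?mul1r // pnatr_eq0 -lt0n ltnW. Qed.

Let u_pow := powers_le_half (ltW u_gt0) u_le2.

Lemma share_ge0 x y : 0 <= share x y.
Proof.
rewrite /share; have [u0 u1] := (u_gt0, u_le2); case: u_pow => ? ? ? ?.
by do !case: ifP => _ //; lra.
Qed.

Lemma share_le1 x y : share x y <= 1.
Proof.
rewrite /share; have [u0 u1] := (u_gt0, u_le2); case: u_pow => ? ? ? ?.
by do !case: ifP => _ //; lra.
Qed.

Lemma weight1_ge0 x y : 0 <= weight1 x y.
Proof. by rewrite divr_ge0 ?share_ge0 ?ler0n. Qed.

Lemma weight2_ge0 x y z : 0 <= weight2 x y z.
Proof. by rewrite divr_ge0 ?subr_ge0 ?share_le1 ?ler0n. Qed.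

Lemma weight_out x y z : (x < z)%N ->
  (g y)%:R * weight1 x y + (g z)%:R * weight2 x y z = 1.
Proof.
move=> ltxz; have gz : ((g z)%:R : rat) != 0.
  by rewrite pnatr_eq0 -lt0n gint_gt0 (leq_ltn_trans _ ltxz).
rewrite /weight1 /weight2 !mulrA ![(g _)%:R * _]mulrC -!mulrA (divff gz) mulr1.
have [y0|y_gt0] := posnP y; last first.
  by rewrite divff ?pnatr_eq0 -?lt0n ?gint_gt0 // mulr1 subrKC.
suff -> : share x y = 0 by rewrite mul0r add0r subr0.
by rewrite y0 /share; case: (x).
Qed.

(** A flag of type [(x, y, z)] covers flags of types [(x - 1, y + 1, z)] and
    [(x, y - 1, z + 1)].  The quotients [R1] and [R2] in the proof compare the
    numbers of flags of these two types with the number of flags of type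
    [(x, y, z)]; [g m / g n] is at most [q^-e] whenever [m + e <= n].  As the
    difference [y - x] is smaller by 3 in the second type, at most one of the two
    shares is a border value.  If both terms are nonzero, the sum is at most
    [1 - q^-2 + q^-2], [2/q] or [1/q + 1/q^2 + 1/q^3]; otherwise the remaining
    quotient is at most 1 or is reduced by a border share.  The truncated predecessors are harmless, since [gint]
    vanishes at 0. *)
Lemma weight_in x y z : (x <= z)%N ->
  (g x)%:R * weight1 x.-1 y.+1 + (g y)%:R * weight2 x y.-1 z.+1 <= 1.
Proof.
move=> lexz; rewrite /weight1 /weight2 ![(g _)%:R * (_ / _)]mulrCA.
set R1 := _ / (g y.+1)%:R; set R2 := _ / (g z.+1)%:R.
have R1_ge0 : 0 <= R1 by rewrite divr_ge0 ?ler0n.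
have R2_ge0 : 0 <= R2 by rewrite divr_ge0 ?ler0n.
have r1 e : (x + e <= y.+1)%N -> R1 <= u ^+ e by exact: gint_ratio_le.
have r2 e : (y + e <= z.+1)%N -> R2 <= u ^+ e by exact: gint_ratio_le.
have [u0 u1] := (u_gt0, u_le2); have [uu2 uu2' uu3 uu3'] := u_pow.
(* Where a quotient may exceed 1, it is at most q + 1 and only the share q^-2
   counts. *)
have R1_big : (x <= y.+2)%N -> u ^+ 2 * R1 <= u + u ^+ 2.
  case: x @R1 R1_ge0 {r1 lexz R2 R2_ge0 r2} => [|x] R1 R1_ge0 lexy.
    rewrite /R1 gint0 mul0r mulr0; lra.
  have /(ler_wpM2l uu2) : R1 <= q%:R + 1 by apply: gintS_ratio_le.
  by rewrite mulrDr mulr1 [_ * q%:R]mulrC qu.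
have R2_big : (y <= z.+2)%N -> u ^+ 2 * R2 <= u + u ^+ 2.
  case: y @R2 R2_ge0 {r1 R1 R1_ge0 r2 R1_big} => [|y] R2 R2_ge0 leyz.
    rewrite /R2 gint0 mul0r mulr0; lra.
  have /(ler_wpM2l uu2) : R2 <= q%:R + 1 by apply: gintS_ratio_le.
  by rewrite mulrDr mulr1 [_ * q%:R]mulrC qu.
have [x0|x_gt0] := posnP x.
 have R10 : R1 = 0 by rewrite /R1 x0 gint0 mul0r.
  rewrite R10 mulr0 add0r x0.
  have [y2|y3|yE] := ltngtP y 2.
  - have := r2 0%N ltac:(nat_lia); rewrite share_0; [lra|nat_lia].
  - rewrite share_1; [lra|nat_lia].
  - have := R2_big ltac:(nat_lia); rewrite share_succ; [lra|nat_lia].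
clearbody R1 R2.
have [ltyx|[yE|[yE|[yE|[yE|[yE|ltxy]]]]]] : (y.+2 < x)%N \/ y.+2 = x \/
    y.+1 = x \/ y = x \/ y = x.+1 \/ y = x.+2 \/ (x.+2 < y)%N by nat_lia.
- have R2_le := r2 0%N ltac:(nat_lia).
  rewrite !share_0; [lra|nat_lia..].
- have R1_le := R1_big ltac:(nat_lia); have R2_le := r2 3%N ltac:(nat_lia).
  rewrite share_diag ?share_0; [lra|nat_lia..].
- have R1_le := r1 0%N ltac:(nat_lia); have R2_le := r2 2%N ltac:(nat_lia).
  have R1u : (1 - u ^+ 2) * R1 <= 1 - u ^+ 2 by apply: ler_piMr; lra.
  rewrite share_succ ?share_0; [lra|nat_lia..].
- have R1_le := r1 1%N ltac:(nat_lia); have R2_le := r2 1%N ltac:(nat_lia).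
  rewrite share_1 ?share_0; [lra|nat_lia..].
- have R1_le := r1 2%N ltac:(nat_lia); have R2_le := r2 0%N ltac:(nat_lia).
  have R2u : (1 - u ^+ 2) * R2 <= 1 - u ^+ 2 by apply: ler_piMr; lra.
  rewrite share_1 ?share_diag; [lra|nat_lia..].
- have R1_le := r1 3%N ltac:(nat_lia); have R2_le := R2_big ltac:(nat_lia).
  rewrite share_1 ?share_succ; [lra|nat_lia..].
- have R1_le := r1 0%N ltac:(nat_lia).
  rewrite !share_1; [lra|nat_lia..].
Qed.

End GaussianIntegers.

(** * Shadows and antichains *)

Section Shadow.
Variable T : finType.

Definition shadow (r : rel T) (F : {set T}) : {set T} :=
  [set t | [exists s in F, r s t]].

(** The fractional matching argument.  [X], [Y], [Z] stand for the type of a flag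
    and [r1], [r2] for its two kinds of covers; stating the lemma for arbitrary
    such data allows it to be used for the reversed order too.  Distributing a
    unit mass from each element of [F] over its covers puts at most 1 on each
    element of the shadow. *)
Lemma leq_card_shadow (q : nat) (X Y Z : T -> nat) (r1 r2 : rel T) (F : {set T}) :
    (1 < q)%N ->
    (forall s t, r1 s t -> [/\ X t = (X s).+1, Y s = (Y t).+1 & Z t = Z s]) ->
    (forall s t, r2 s t -> [/\ X t = X s, Y t = (Y s).+1 & Z s = (Z t).+1]) ->
    (forall s, #|[pred t | r1 s t]| = gint q (Y s)) ->
    (forall s, #|[pred t | r2 s t]| = gint q (Z s)) ->
    (forall t, #|[pred s | r1 s t]| = gint q (X t)) ->
    (forall t, #|[pred s | r2 s t]| = gint q (Y t)) ->
    (forall s, s \in F -> (X s < Z s)%N) ->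
  (#|F| <= #|shadow [rel s t | r1 s t || r2 s t] F|)%N.
Proof.
move=> q_gt1 r1P r2P out1 out2 in1 in2 ltXZ.
pose w1 s := weight1 q (X s) (Y s); pose w2 s := weight2 q (X s) (Y s) (Z s).
pose D := shadow [rel s t | r1 s t || r2 s t] F.
have memD s t : s \in F -> r1 s t || r2 s t -> t \in D.
  by move=> sF rst; rewrite inE; apply/existsP; exists s; rewrite sF.
rewrite -(ler_nat rat) -!sum1_card !natr_sum.
have sum_const (A : pred T) (c : rat) : \sum_(s | A s) c = #|A|%:R * c.
  by rewrite sumr_const mulr_natl.
have -> : \sum_(s in F) 1%:R =
    \sum_(s in F) (\sum_(t | r1 s t) w1 s + \sum_(t | r2 s t) w2 s).
  apply: eq_bigr => s sF.
  by rewrite !sum_const out1 out2 weight_out // ltXZ.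
rewrite big_split /= (exchange_big_dep (mem D)) /=; last first.
  by move=> s t sF rst; apply: (memD s) => //; rewrite rst.
rewrite [X in _ + X](exchange_big_dep (mem D)) /=; last first.
  by move=> s t sF rst; apply: (memD s) => //; rewrite rst orbT.
rewrite -big_split /=; apply: ler_sum => t.
rewrite inE => /existsP[s0 /andP[s0F rs0t]].
have leXZ : (X t <= Z t)%N.
  have := ltXZ _ s0F.
  by case/orP: rs0t => [/r1P[-> _ ->] //|/r2P[-> _ ->]]; rewrite ltnS.
have sum_sub (r : rel T) (w : T -> rat) : (forall s, 0 <= w s) ->
    \sum_(s in F | r s t) w s <= \sum_(s | r s t) w s.
  move=> w_ge0; rewrite big_mkcondl /=; apply: ler_sum => s _.
  by case: ifP => // _; apply: w_ge0.
apply: le_trans (weight_in q_gt1 (Y t) leXZ); apply: lerD.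
  apply: le_trans (sum_sub r1 w1 (fun s => weight1_ge0 q_gt1 _ _)) _.
  rewrite -in1 -sum_const; apply: ler_sum => s /r1P[Xt Ys _].
  by rewrite /w1 Xt Ys.
apply: le_trans (sum_sub r2 w2 (fun s => weight2_ge0 q_gt1 _ _ _)) _.
rewrite -in2 -sum_const; apply: ler_sum => s /r2P[Xt Yt Zs].
by rewrite /w2 Xt Yt Zs.
Qed.

(** Here [M] is the rank towards which antichains are pushed; [lt] is a mere
    relation, so that the reversed order is covered. *)
Section Lifting.
Variables (lt cov : rel T) (rk : T -> nat) (M : nat).
Hypothesis lt_trans : transitive lt.
Hypothesis lt_rk : forall s t, lt s t -> (rk s < rk t)%N.
Hypothesis cov_lt : forall s t, cov s t -> lt s t.
Hypothesis cov_rk : forall s t, cov s t -> rk t = (rk s).+1.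
Hypothesis shadow_large : forall F : {set T},
  (forall s, s \in F -> (rk s < M)%N) -> (#|F| <= #|shadow cov F|)%N.

(** One step replaces the elements of rank [m] by their shadow.  A shadow element
    below or equal to a remaining one would put an element of the current
    antichain below another, so the result is an antichain and the union is
    disjoint.  The last clause records that nothing is created above rank [m]. *)
Lemma lift_antichain m (F : {set T}) : (m <= M)%N ->
    {in F &, forall s t, ~~ lt s t} ->
  exists F' : {set T}, [/\ {in F' &, forall s t, ~~ lt s t}, (#|F| <= #|F'|)%N
    & forall t, t \in F' -> (m <= rk t)%N /\ (t \in F \/ (rk t <= m)%N)].
Proof.
move=> lemM antiF; elim: m lemM => [|m IHm] ltmM.
  by exists F; split=> // t tF; split=> //; left.
have [G [antiG leFG rkG]] := IHm (ltnW ltmM).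
pose G0 := [set t in G | rk t == m]; pose D := shadow cov G0.
have memD t : t \in D -> exists2 s, s \in G & cov s t /\ rk t = m.+1.
  rewrite inE => /existsP[s /andP[]]; rewrite inE => /andP[sG /eqP rks] cst.
  by exists s => //; rewrite (cov_rk cst) rks.
have memGD t : t \in G :\: G0 -> t \in G /\ (m < rk t)%N.
  rewrite !inE => /andP[+ tG]; rewrite tG /= => rkt; split=> //.
  by rewrite ltn_neqAle eq_sym rkt; case: (rkG t tG).
have GD_disj t : t \in G -> t \in D -> False.
  move=> tG /memD[s sG [cst _]]; have := antiG s t sG tG.
  by rewrite (cov_lt cst).
exists ((G :\: G0) :|: D); split.
- move=> s t /setUP[/memGD[sG rks]|/memD[s' s'G [cs's rks]]]
    /setUP[/memGD[tG rkt]|/memD[t' t'G [ct't rkt]]].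
  + exact: antiG.
  + by apply/negP => /lt_rk; rewrite rkt ltnS leqNgt rks.
  + apply/negP => ltst; have := antiG s' t s'G tG.
    by rewrite (lt_trans (cov_lt cs's) ltst).
  + by apply/negP => /lt_rk; rewrite rks rkt ltnn.
- have disj : [disjoint G :\: G0 & D].
    rewrite disjoint_subset; apply/subsetP => t /memGD[tG _].
    by rewrite inE; apply/negP => /(GD_disj t tG).
  have := leq_card_setU (G :\: G0) D; rewrite disj => /leqifP/eqP ->.
  rewrite (leq_trans leFG) // -(cardsID G0 G) addnC leq_add2l.
  have /setIidPr -> : G0 \subset G by apply/subsetP => t; rewrite inE => /andP[].
  by apply: shadow_large => s; rewrite inE => /andP[_ /eqP ->].
- move=> t /setUP[/memGD[tG rkt]|/memD[s sG [_ rkt]]].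
    by split=> //; have [_ [|rktm]] := rkG t tG; [left|right; rewrite leqW].
  by rewrite rkt; split=> //; right.
Qed.
End Lifting.
End Shadow.

(** * Counting subspaces *)

(** The alias [finvect_type] makes the vectors countable; the packed structure is
    opened in the proof so that [vT] and its alias visibly share their
    operations. *)
Lemma card_mem_vspace (k : finFieldType) (vT : vectType k) (X : {vspace vT}) :
  #|[pred v : finvect_type vT | v \in X]| = (#|k| ^ \dim X)%N.
Proof.
case: vT X => T cT X; exact: (@card_vspace k (finvect_type (Vector.Pack cT)) cT X).
Qed.

Section CountingSubspaces.
Variables (k : finFieldType) (vT : vectType k).
Implicit Types U W X : {vspace vT}.
Local Notation q := #|k|.
Local Notation g := (gint q).

Definition superlines U W :=
  [pred X | (U <= X <= W)%VS && (\dim X == (\dim U).+1)].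
Definition hyperplanes U W :=
  [pred X | (U <= X <= W)%VS && ((\dim X).+1 == \dim W)].

(** Each vector of [W] outside [U] lies in exactly one [X], namely [U + <[v]>],
    so the sets [X] minus [U] partition [W] minus [U]. *)
Lemma card_superlines U W : (U <= W)%VS ->
  #|superlines U W| = g (\dim W - \dim U).
Proof.
move=> sUW; have q_gt1 : (1 < q)%N := finNzRing_gt1 k.
pose fT : finType := finvect_type vT.
have cardU X : #|[pred v : fT | v \in X]| = (q ^ \dim X)%N.
  exact: card_mem_vspace.
have cardD X : (U <= X)%VS ->
    #|[pred v : fT | (v \in X) && (v \notin U)]| = (q ^ \dim X - q ^ \dim U)%N.
  move=> sUX; rewrite -!cardU -[in RHS](cardID [pred v : fT | v \in U]).
  rewrite [X in (X + _ - _)%N](_ : _ = #|[pred v : fT | v \in U]|) ?addKn.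
    by apply: eq_card => v; rewrite !inE andbC.
  apply: eq_card => v; rewrite !inE andb_idl //; exact: (subvP sUX).
have dbl : (\sum_(X | superlines U W X) \sum_(v : fT | (v \in X) && (v \notin U)) 1
   = \sum_(v : fT | (v \in W) && (v \notin U)) 1)%N.
  rewrite (exchange_big_dep (fun v : fT => (v \in W) && (v \notin U))) /=;
    last first.
    by move=> X v /andP[/andP[_ sXW] _] /andP[vX ->]; rewrite (subvP sXW).
  apply: eq_bigr => v /andP[vW vU]; rewrite sum1_card.
  rewrite (eq_card (B := pred1 (U + <[v : vT]>)%VS)) ?card1 // => X.
  rewrite !inE; apply/idP/eqP => [/andP[/andP[/andP[sUX sXW] dX] /andP[vX _]]|->].
    apply/esym/eqP; rewrite eqEdim subv_add sUX -memvE vX /=.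
    by rewrite (eqP dX) dim_add_line.
  rewrite unfold_in /= addvSl subv_add sUW -memvE vW dim_add_line // eqxx vU /=.
  rewrite andbT; exact: (subvP (addvSr U <[v : vT]>) v (memv_line (v : vT))).
have {dbl} : (#|superlines U W| * (q ^ (\dim U).+1 - q ^ \dim U)
    = q ^ \dim W - q ^ \dim U)%N.
  rewrite -(cardD W sUW) -[RHS]sum1_card -dbl -sum_nat_const.
  apply: eq_bigr => X /andP[/andP[sUX _] /eqP dX].
  by rewrite sum1_card cardD // dX.
have qU : (0 < q ^ \dim U)%N by rewrite expn_gt0 (ltnW q_gt1).
have -> : (q ^ \dim W = q ^ \dim U * q ^ (\dim W - \dim U))%N.
  by rewrite -expnD subnKC ?dimvS.
rewrite expnS.
have := gint_predn q_gt1 (\dim W - \dim U).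
set G := gint _ _; set S := #|superlines U W|; set e := (q ^ (_ - _))%N.
move: (q ^ \dim U)%N qU => p p_gt0 Ge SE.
have : (S * (p * q.-1) = G * (p * q.-1))%N.
  rewrite [RHS]mulnCA Ge mulnBr muln1 -SE; congr (_ * _)%N.
  by rewrite -subn1 mulnBr muln1 [in RHS]mulnC.
move/eqP; rewrite eqn_pmul2r => [/eqP //|].
by rewrite muln_gt0 p_gt0 -subn1 subn_gt0.
Qed.

(** Duality is avoided by counting pairs [Y <= X] with [Y] one dimension above [U]
    and [X] one below [W] in two ways.  For [d = dim W - dim U], each [X] contains
    [g (d - 1)] such [Y], and by induction each [Y] lies in [g (d - 1)] such [X];
    hence there are as many [X] as [Y].  The factor [g (d - 1)] cancels only for
    [d >= 2]. *)
Lemma card_hyperplanes U W : (U <= W)%VS ->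
  #|hyperplanes U W| = g (\dim W - \dim U).
Proof.
have q_gt1 : (1 < q)%N := finNzRing_gt1 k.
move dE: (\dim W - \dim U)%N => d.
elim: d U dE => [|d IHd] U dE sUW.
  rewrite gint0 eq_card0 // => X; rewrite !inE.
  apply/negP => /andP[/andP[sUX sXW] /eqP dX].
  by have := dimvS sUX; lia.
have [d0|d_gt0] := posnP d.
  rewrite d0 gintS gint0 muln0 (eq_card (B := pred1 U)) ?card1 // => X.
  rewrite !inE; apply/idP/eqP => [/andP[/andP[sUX sXW] /eqP dX]|->].
    by apply/esym/eqP; rewrite eqEdim sUX; lia.
  by rewrite subvv sUW; lia.
have dbl : (\sum_(X | hyperplanes U W X) \sum_(Y | superlines U X Y) 1
   = \sum_(Y | superlines U W Y) \sum_(X | hyperplanes Y W X) 1)%N.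
  rewrite (exchange_big_dep (superlines U W)) /=; last first.
    move=> X Y /andP[/andP[_ sXW] _] /andP[/andP[sUY sYX] dY].
    by rewrite sUY (subv_trans sYX sXW).
  apply: eq_bigr => Y /andP[/andP[sUY sYW] dY]; apply: eq_bigl => X /=.
  rewrite sUY dY andbT /=; case sYX: (Y <= X)%VS; rewrite ?andbF //=.
  by rewrite (subv_trans sUY sYX) andbT.
have : (#|hyperplanes U W| * g d = g d.+1 * g d)%N.
  rewrite -[in RHS]dE -(card_superlines sUW) -!sum_nat_const.
  transitivity (\sum_(X | hyperplanes U W X) \sum_(Y | superlines U X Y) 1)%N.
    apply: eq_bigr => X /andP[/andP[sUX sXW] /eqP dX].
    by rewrite sum1_card card_superlines //; congr g; lia.
  rewrite dbl; apply: eq_bigr => Y /andP[/andP[sUY sYW] /eqP dY].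
  rewrite sum1_card.
  by rewrite IHd //; lia.
by move/eqP; rewrite eqn_pmul2r ?gint_gt0 // => /eqP ->.
Qed.

End CountingSubspaces.

(** * Two-step flags *)

Section Flags.
Variables (k : finFieldType) (E : vectType k).
Local Notation q := #|k|.
Local Notation g := (gint q).
Local Notation N := (\dim {:E}).
Local Notation V := (@Rep k E E \1%VF).
Implicit Types (U W : subrep V) (A B : {vspace E}).

Lemma sub12 U : (sub1 U <= sub2 U)%VS.
Proof. by have := subrepP U; rewrite /= lim1g. Qed.

Lemma flag_exists A B : (A <= B)%VS ->
  exists U, sub1 U = A /\ sub2 U = B.
Proof.
move=> sAB; have UP : (rep_map V @: (A, B).1 <= (A, B).2)%VS by rewrite /= lim1g.
by exists (@Subrep k V _ UP).
Qed.

Definition dim1 U := \dim (sub1 U).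
Definition dim2 U := \dim (sub2 U).

Lemma subrep_dimE U : subrep_dim U = (dim1 U + dim2 U)%N.
Proof. by []. Qed.

Lemma dim12 U : (dim1 U <= dim2 U)%N.
Proof. exact: dimvS (sub12 U). Qed.

Lemma dim2_le U : (dim2 U <= N)%N.
Proof. exact: dimvS (subvf (sub2 U)). Qed.

(** The covers of [U], according to the component that grows. *)
Definition raise1 U W :=
  [&& sub2 W == sub2 U, (sub1 U <= sub1 W)%VS & \dim (sub1 W) == (\dim (sub1 U)).+1].

Definition raise2 U W :=
  [&& sub1 W == sub1 U, (sub2 U <= sub2 W)%VS & \dim (sub2 W) == (\dim (sub2 U)).+1].

Lemma card_flags (P : pred (subrep V)) (f : subrep V -> {vspace E})
    (Q : pred {vspace E}) :
    {in P &, injective f} -> (forall U, P U -> Q (f U)) ->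
    (forall A, Q A -> exists2 U, P U & f U = A) -> #|P| = #|Q|.
Proof.
move=> f_inj fPQ fQP; rewrite -(card_in_image f_inj); apply: eq_card => A.
apply/imageP/idP => [[U PU ->]|/fQP[U PU <-]]; [exact: fPQ | by exists U].
Qed.

Lemma card_raise1_out U : #|[pred W | raise1 U W]| = g (dim2 U - dim1 U).
Proof.
rewrite -(card_superlines (sub12 U)); apply: (card_flags (f := @sub1 k V)).
- move=> W W' /and3P[/eqP e _ _] /and3P[/eqP e' _ _] eW.
  by apply: subrep_eq => //; rewrite e e'.
- by move=> W /and3P[/eqP e s d]; rewrite /= s d -e sub12.
- move=> A /andP[/andP[sA sA2] d]; have [W [W1 W2]] := flag_exists sA2.
  by exists W; rewrite //= /raise1 W1 W2 eqxx sA d.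
Qed.

Lemma card_raise2_out U : #|[pred W | raise2 U W]| = g (N - dim2 U).
Proof.
rewrite -(card_superlines (subvf (sub2 U))); apply: (card_flags (f := @sub2 k V)).
- move=> W W' /and3P[/eqP e _ _] /and3P[/eqP e' _ _] eW.
  by apply: subrep_eq => //; rewrite e e'.
- by move=> W /and3P[/eqP e s d]; rewrite /= s d subvf.
- move=> A /andP[/andP[sA _] d].
  have [W [W1 W2]] := flag_exists (subv_trans (sub12 U) sA).
  by exists W; rewrite //= /raise2 W1 W2 eqxx sA d.
Qed.

Lemma card_raise1_in W : #|[pred U | raise1 U W]| = g (dim1 W).
Proof.
have -> : dim1 W = (dim1 W - \dim (0 : {vspace E})%VS)%N.
  by rewrite dimv0 subn0.
rewrite -(card_hyperplanes (sub0v (sub1 W))); apply: (card_flags (f := @sub1 k V)).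
- move=> U U' /and3P[/eqP e _ _] /and3P[/eqP e' _ _] eU.
  by apply: subrep_eq => //; rewrite -e -e'.
- by move=> U /and3P[/eqP e s d]; rewrite /= s eq_sym d sub0v.
- move=> A /andP[/andP[_ sA] d].
  have [U [U1 U2]] := flag_exists (subv_trans sA (sub12 W)).
  by exists U; rewrite //= /raise1 U1 U2 eqxx sA eq_sym d.
Qed.

Lemma card_raise2_in W : #|[pred U | raise2 U W]| = g (dim2 W - dim1 W).
Proof.
rewrite -(card_hyperplanes (sub12 W)); apply: (card_flags (f := @sub2 k V)).
- move=> U U' /and3P[/eqP e _ _] /and3P[/eqP e' _ _] eU.
  by apply: subrep_eq => //; rewrite -e -e'.
- by move=> U /and3P[/eqP e s d]; rewrite /= s eq_sym d e sub12.
- move=> A /andP[/andP[sWA sA] d]; have [U [U1 U2]] := flag_exists sWA.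
  by exists U; rewrite //= /raise2 U1 U2 eqxx sA eq_sym d.
Qed.

Lemma raise1_lt U W : raise1 U W -> (U < W)%O.
Proof.
move=> /and3P[/eqP e s /eqP d]; rewrite lt_neqAle; apply/andP; split.
  by apply/eqP => eUW; move: d; rewrite eUW; lia.
by apply/andP; rewrite s e subvv.
Qed.

Lemma raise2_lt U W : raise2 U W -> (U < W)%O.
Proof.
move=> /and3P[/eqP e s /eqP d]; rewrite lt_neqAle; apply/andP; split.
  by apply/eqP => eUW; move: d; rewrite eUW; lia.
by apply/andP; rewrite s e subvv.
Qed.

Lemma raise1_dims U W : raise1 U W ->
  [/\ dim1 W = (dim1 U).+1,
      (dim2 U - dim1 U = (dim2 W - dim1 W).+1)%N
    & (N - dim2 W = N - dim2 U)%N].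
Proof.
move=> /and3P[/eqP e _ /eqP d]; rewrite -/(dim1 _) -/(dim1 U) in d.
have e2 : dim2 W = dim2 U by rewrite /dim2 e.
by have := dim12 W; split; lia.
Qed.

Lemma raise2_dims U W : raise2 U W ->
  [/\ dim1 W = dim1 U,
      (dim2 W - dim1 W = (dim2 U - dim1 U).+1)%N
    & (N - dim2 U = (N - dim2 W).+1)%N].
Proof.
move=> /and3P[/eqP e _ /eqP d]; rewrite -/(dim2 _) -/(dim2 U) in d.
have e1 : dim1 W = dim1 U by rewrite /dim1 e.
by have := dim12 U; have := dim2_le W; split; lia.
Qed.

Lemma raise1_rank U W : raise1 U W -> subrep_dim W = (subrep_dim U).+1.
Proof.
move=> /raise1_dims[d1 d2 _]; have [le1 le2] := (dim12 U, dim12 W).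
by rewrite !subrep_dimE; lia.
Qed.

Lemma raise2_rank U W : raise2 U W -> subrep_dim W = (subrep_dim U).+1.
Proof.
move=> /raise2_dims[d1 d2 _]; have [le1 le2] := (dim12 U, dim12 W).
by rewrite !subrep_dimE; lia.
Qed.

Lemma subrep_dim_lt U W : (U < W)%O -> (subrep_dim U < subrep_dim W)%N.
Proof.
rewrite lt_neqAle => /andP[/eqP neq /andP[s1 s2]].
rewrite ltnNge; apply/negP => le; apply: neq.
have d1 : (dim1 U <= dim1 W)%N := dimvS s1.
have d2 : (dim2 U <= dim2 W)%N := dimvS s2.
rewrite !subrep_dimE in le.
have e1 : (dim1 W <= dim1 U)%N by lia.
have e2 : (dim2 W <= dim2 U)%N by lia.
by apply: subrep_eq; apply/eqP; rewrite eqEdim ?s1 ?s2.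
Qed.

Lemma leq_card_upper_shadow (F : {set subrep V}) :
    (forall U, U \in F -> (subrep_dim U < N)%N) ->
  (#|F| <= #|shadow [rel U W | raise1 U W || raise2 U W] F|)%N.
Proof.
move=> rkF; apply: (@leq_card_shadow _ q (fun U => dim1 U)
  (fun U => dim2 U - dim1 U)%N (fun U => N - dim2 U)%N).
- exact: finNzRing_gt1.
- exact: raise1_dims.
- exact: raise2_dims.
- exact: card_raise1_out.
- exact: card_raise2_out.
- exact: card_raise1_in.
- exact: card_raise2_in.
- by move=> U /rkF; rewrite subrep_dimE; lia.
Qed.

(** Same estimate for the reversed order: shrinking [sub2] now plays the part of
    enlarging [sub1], and the type is read backwards. *)
Lemma leq_card_lower_shadow (F : {set subrep V}) :
    (forall U, U \in F -> (N < subrep_dim U)%N) ->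
  (#|F| <= #|shadow [rel W U | raise2 U W || raise1 U W] F|)%N.
Proof.
move=> rkF; apply: (@leq_card_shadow _ q (fun U => N - dim2 U)%N
  (fun U => dim2 U - dim1 U)%N (fun U => dim1 U)
  (fun W U => raise2 U W) (fun W U => raise1 U W)).
- exact: finNzRing_gt1.
- by move=> W U /raise2_dims[].
- by move=> W U /raise1_dims[].
- exact: card_raise2_in.
- exact: card_raise1_in.
- exact: card_raise2_out.
- exact: card_raise1_out.
- by move=> U /rkF; rewrite subrep_dimE; have := dim2_le U; lia.
Qed.

Lemma subrep_dim_le U : (subrep_dim U <= N + N)%N.
Proof. by rewrite leq_add ?dim2_le // (leq_trans (dim12 U)) ?dim2_le. Qed.

Lemma flag_poset_Sperner : Sperner (subrep_poset V).
Proof.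
exists N => F antiF.
have {}antiF : {in F &, forall U W : subrep V, ~~ (U < W)%O}.
  move=> U W UF WF; apply/negP => ltUW.
  have := antiF U W UF WF (negbT (lt_eqF ltUW)).
  by rewrite /Order.comparable (ltW ltUW).
(* G has no element below degree N; pushing it down only adds elements of degree
   N, so the result H lies in that level. *)
have [G [antiG leFG rkG]] : exists G : {set subrep V},
    [/\ {in G &, forall U W, ~~ (U < W)%O}, (#|F| <= #|G|)%N
      & forall U, U \in G -> (N <= subrep_dim U)%N].
  have [|||||G [? ? rkG]] := @lift_antichain _ [rel U W | (U < W)%O]
    [rel U W | raise1 U W || raise2 U W] (@subrep_dim k V) N _ _ _ _ _ N F
    (leqnn N) antiF.
  - exact: lt_trans.
  - exact: subrep_dim_lt.
  - by move=> U W /orP[/raise1_lt|/raise2_lt].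
  - by move=> U W /orP[/raise1_rank|/raise2_rank].
  - exact: leq_card_upper_shadow.
  by exists G; split=> // U /rkG[].
have [||||||H [_ leGH rkH]] := @lift_antichain _ [rel W U | (U < W)%O]
  [rel W U | raise2 U W || raise1 U W] (fun U => N + N - subrep_dim U)%N N
  _ _ _ _ _ N G (leqnn N) _.
- by move=> U W X /= h1 h2; apply: lt_trans h2 h1.
- by move=> W U /= /subrep_dim_lt; have := subrep_dim_le W; lia.
- by move=> W U /= /orP[/raise2_lt|/raise1_lt].
- move=> W U /= /orP[/raise2_rank|/raise1_rank]; have := subrep_dim_le W; lia.
- by move=> A rkA; apply: leq_card_lower_shadow => U /rkA; lia.
- by move=> W U WG UG; apply: antiG.
apply: leq_trans (leq_trans leFG leGH) (subset_leq_card _).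
apply/subsetP => U /rkH[rkU [/rkG|]]; rewrite inE /=;
  have := subrep_dim_le U; lia.
Qed.

End Flags.

Theorem theorem3p2 (k : finFieldType) (q : nat) (hq : #|k| = q) (a : nat) :
  Sperner (subrep_poset (rep_pow a (P1 k))).
Proof.
pose E : vectType k := {ffun 'I_a -> k^o}.
have -> : rep_pow a (P1 k) = @Rep k E E \1%VF.
  congr Rep; apply/lfunP => v; rewrite !lfunE; apply/ffunP => i.
  by rewrite ffunE lfunE.
exact: flag_poset_Sperner.
Qed.
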